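(* Let $G$ be a chordless graph of maximum degree $\Delta \ge 1$. Then $$\chi_s'(G) \le 4\Delta - 3.$$
   Context: All graphs are finite, simple and undirected. A graph is chordless if every cycle in it is induced, i.e. no two non-consecutive vertices of a cycle are adjacent in the graph. A strong edge coloring of $G$ is a coloring of the edges of $G$ in which every color class is an induced matching, that is, any two distinct edges of the same color share no vertex, and no vertex of one is adjacent in $G$ to a vertex of the other. The strong chromatic index $\chi_s'(G)$ is the minimum number of colors in a strong edge coloring of $G$. *)

(* Defs.v *)
From mathcomp Require Import all_boot.

Set Implicit Arguments.
Unset Strict Implicit.
Unset Printing Implicit Defensive.

(* A graph is given by its adjacency relation e : rel T on a finite vertex
   type T.  It is simple and undirected when e is symmetric and irreflexive;
   these two properties are hypotheses of the statements, not of the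
   definitions. *)

Definition degree (T : finType) (e : rel T) (x : T) : nat :=
  #|[set y | e x y]|.

Definition max_degree (T : finType) (e : rel T) : nat :=
  \max_(x : T) degree e x.

(* A cycle of the graph is a sequence of at least three distinct vertices,
   cyclically adjacent; the lower bound on the size excludes the empty
   sequence and the pairs [:: x; y] with e x y, which also satisfy ucycle. *)
Definition graph_cycle (T : finType) (e : rel T) (c : seq T) : Prop :=
  2 < size c /\ ucycle e c.

Definition consecutive (T : finType) (c : seq T) (x y : T) : bool :=
  (y == next c x) || (x == next c y).

Definition induced_cycle (T : finType) (e : rel T) (c : seq T) : Prop :=
  {in c &, forall x y, ~~ consecutive c x y -> ~~ e x y}.

Definition chordless (T : finType) (e : rel T) : Prop :=
  forall c : seq T, graph_cycle e c -> induced_cycle e c.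

(* An edge is the unordered pair of its ends, as a set of vertices. *)
Definition edges (T : finType) (e : rel T) : {set {set T}} :=
  [set [set p.1; p.2] | p : T * T & e p.1 p.2].

Definition edge (T : finType) (e : rel T) := {A : {set T} | A \in edges e}.

Definition induced_matching (T : finType) (e : rel T) (M : {set edge e}) :
    bool :=
  [forall A in M, forall B in M, (A != B) ==>
    [disjoint val A & val B] &&
    [forall x in val A, forall y in val B, ~~ e x y]].

Definition strong_edge_coloring (T : finType) (e : rel T) (k : nat)
    (f : {ffun edge e -> 'I_k}) : bool :=
  [forall i : 'I_k, induced_matching [set A | f A == i]].

(* Colors are assigned to the edges only, so that an edgeless graph is
   colorable with k = 0 colors. *)
Definition strong_edge_colorable (T : finType) (e : rel T) (k : nat) : bool :=
  [exists f : {ffun edge e -> 'I_k}, strong_edge_coloring f].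

Lemma strong_edge_colorable_ex (T : finType) (e : rel T) :
  exists k, strong_edge_colorable e k.
Proof.
exists #|{: edge e}|; apply/existsP; exists [ffun A => enum_rank A].
apply/forallP=> i; apply/forall_inP=> A; rewrite inE ffunE => /eqP Ai.
apply/forall_inP=> B; rewrite inE ffunE -Ai => /eqP/enum_rank_inj->.
by rewrite eqxx.
Qed.

Definition strong_chromatic_index (T : finType) (e : rel T) : nat :=
  ex_minn (strong_edge_colorable_ex e).

(* Main.v *)
Require Import Defs.
From mathcomp Require Import all_boot.
From mathcomp Require Import zify.

Set Implicit Arguments.
Unset Strict Implicit.
Unset Printing Implicit Defensive.

(** Let d be the maximum degree.  The edges are peeled off in an order in which
each edge conflicts with at most 4d - 4 of the edges that are peeled off with
it or after it; coloring them greedily in the reverse order then uses at most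
4d - 3 colors.

Write r for the graph of the edges that are still present.  Conflicts are those
of the whole graph e, so a removed edge xy still makes the present edges at x
conflict with those at y.  The peeling keeps this harmless: if both ends of a
removed edge still have present edges, each has exactly one
([removal_inert]).  The number of present edges that conflict with the present
edge vu is at most the sum of the r-degrees of the e-neighbors of v other than
u and of the e-neighbors of u other than v ([card_conflicts]).  Two kinds of
present edges vu make this sum at most 4d - 4 and keep the invariant when they
are removed:
- u has degree at most 2 and at most one neighbor of v has degree at least 3;
  the neighbors of v contribute at most 2(d - 1) + (d - 2) and those of u at
  most d (for d = 1 both sums are 0); all such edges at v are removed together;
- u has degree 1 and at most two neighbors of v have degree at least 2; the
  neighbors of v contribute at most (d - 1) + 2(d - 1) and those of u at most
  d - 1.

It remains to see that every chordless graph with an edge has one of them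
([chordless_reducible]).  If not, delete the vertices of degree at most 1, and
let D be the set of the vertices of degree at least 3.  Then every vertex of D
keeps at least three neighbors, two of them in D; every other vertex that keeps
an edge keeps two, both in D.  This is impossible in a chordless graph
([no_branching_core]), essentially because the vertices of degree at least 3 of
a 2-connected chordless graph induce a forest.  The proof here does not go
through blocks.  In a chordless graph no cycle avoiding an edge xy can pass
through both x and y, hence, by Menger's theorem for two paths, a vertex z
separates x from y once the edge is removed ([chordless_separation]).  One takes
a minimal set A0 that meets D and can be left only towards one vertex, and then
a minimal set A inside A0 that can be left only towards one vertex or along one
edge xy with x in D.  Separating x from another neighbor in D always cuts out
a smaller set of one of the two types. *)

(** * Two internally disjoint paths *)

Section TwoPaths.

Variables (T : finType) (g : rel T).
Hypothesis g_sym : symmetric g.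

Lemma split_last_has (a : pred T) (s : seq T) :
  has a s -> exists s1 r s2, [/\ s = s1 ++ r :: s2, a r & ~~ has a s2].
Proof.
elim: s => //= w s IHs; case: (boolP (has a s)) => [/IHs|noa].
  by case=> s1 [r [s2 [-> ar nas2]]] _; exists (w :: s1), r, s2.
by rewrite orbF => aw; exists [::], w, s.
Qed.

(** One of the two arcs from c to r of a cycle goes through any given third
vertex x. *)
Lemma arc_through (C : seq T) (c r x : T) :
    ucycle g C -> c \in C -> r \in C -> x \in C -> r != c -> x != c ->
  exists A, [/\ path g c (rcons A r), uniq (c :: rcons A r),
                {subset rcons A r <= C} & x \in rcons A r].
Proof.
move=> /andP[cycC uC] /rot_to[i C1 defC].
rewrite -!(mem_rot i C) defC !inE => rC xC rc xc.
have subC w : w \in c :: C1 -> w \in C by rewrite -defC mem_rot.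
have {}cycC : cycle g (c :: C1) by rewrite -defC rot_cycle.
have {}uC : uniq (c :: C1) by rewrite -defC rot_uniq.
rewrite (negPf rc) (negPf xc) /= in rC xC.
case/splitPr: rC => A B in cycC uC subC xC {defC}.
have [xAr|xAr] := boolP (x \in rcons A r).
  exists A; split=> //.
  - by move: cycC; rewrite -cat_rcons /= rcons_cat cat_path => /andP[].
  - by move: uC; rewrite -cat_rcons -cat_cons cat_uniq => /andP[].
  by move=> w wAr; rewrite subC // -cat_rcons inE mem_cat wAr orbT.
have xB : x \in B.
  by move: xC xAr; rewrite mem_rcons mem_cat !inE; case: (x \in A); case: eqP.
exists (rev B); split.
- move: cycC; rewrite /= rcons_cat rcons_cons cat_path /= => /and3P[_ _].
  rewrite -rev_path last_rcons belast_rcons rev_cons.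
  by rewrite (eq_path (e' := g)) // => a b; exact: g_sym.
- move: uC; rewrite -rev_cons /= rev_uniq mem_rev mem_cat negb_or cat_uniq.
  by case/andP=> /andP[_ ->] /and3P[].
- move=> w; rewrite -rev_cons mem_rev => wB; rewrite subC //.
  by rewrite inE mem_cat wB !orbT.
by rewrite mem_rcons inE mem_rev xB orbT.
Qed.

(** Whitney's argument for Menger's theorem with two paths.  The cycle C passes
through x, and the path Q leads from a vertex c of C to y.  Since c does not
separate x from y, some path leaves C at a vertex r <> c and meets Q further on,
at q; the arc of C from c to r through x, followed by this path and by the part
of Q between q and c, is a cycle through x that is closer to y along Q. *)
Lemma grow_cycle (x y : T) (n : nat) (C : seq T) (c : T) (Q : seq T) :
    (forall z, z != x -> z != y ->
       connect [rel a b | g a b && (b != z)] x y) ->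
    size Q <= n -> ucycle g C -> x \in C -> c \in C -> c != x ->
    path g c Q -> uniq Q -> last c Q = y -> ~~ has (mem C) Q ->
  exists C', [/\ ucycle g C', x \in C' & y \in C'].
Proof.
move=> bypass; elim: n => [|n IHn] in C c Q *.
  by case: Q => // _ ucC xC cC _ _ _ <- _; exists C.
move=> szQ ucC xC cC cx pQ uQ lQ CQ.
have [cy|cy] := eqVneq c y; first by exists C; rewrite -cy.
have xQ : x \notin Q by apply: contra CQ => xQ; apply/hasP; exists x.
have yQ : y \in Q.
  by move: (mem_last c Q); rewrite lQ inE eq_sym (negPf cy).
have /connectP[p0 /shortenP[p pp up _]] := bypass c cx cy.
move=> {p0} lp.
have cp : c \notin p.
  elim: (p) (x) pp => //= w p' IHp v /andP[/andP[_ wc] /IHp].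
  by rewrite inE eq_sym (negPf wc).
have {}pp : path g x p.
  by apply: sub_path pp => a b /andP[].
(* R is the part of the bypass p between its last vertex r on C and its first
   vertex q on Q. *)
have hQ : has (mem Q) p.
  apply/hasP; exists y => //; move: (mem_last x p); rewrite -lp inE.
  by case/predU1P=> // yx; rewrite -yx yQ in xQ.
case/split_find: hQ pp up cp {lp} => q p1 p2 qQ p1Q.
rewrite cat_path cat_rcons -cat_cons cat_uniq => /andP[pp1 _] /andP[up1 _].
rewrite mem_cat negb_or => /andP[cp1 _].
have /split_last_has[s1 [r [R [defs rC RC]]]] : has (mem C) (x :: p1).
  by rewrite /= xC.
have pR : path g r (rcons R q).
  case: s1 defs => [|w s1] /= [-> defp] in pp1 *; first by rewrite -defp.
  by move: pp1; rewrite defp rcons_cat rcons_cons cat_path /= => /and3P[].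
have uR : uniq (r :: R) by move: up1; rewrite defs cat_uniq => /and3P[].
have subR w : w \in R -> w \in x :: p1.
  by rewrite defs mem_cat inE => ->; rewrite !orbT.
have cxp1 : c \notin x :: p1 by rewrite inE (negPf cx).
have rc : r != c.
  by apply: contraNneq cxp1 => <-; rewrite defs mem_cat mem_head orbT.
have RQ w : w \in R -> w \notin Q.
  move/subR; rewrite inE; case/predU1P => [-> //|wp1].
  by apply: contra p1Q => wQ; apply/hasP; exists w.
have xc : x != c by rewrite eq_sym.
have [A [pA uA AC xA]] := arc_through ucC cC rC xC rc xc.
have notC w : w \in Q -> w \notin C.
  by move=> wQ; apply: contra CQ => wC; apply/hasP; exists w.
have RnC w : w \in R -> w \notin C.
  by move=> wR; apply: contra RC => wC; apply/hasP; exists w.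
case/splitPr: qQ => Q1 Q2 in szQ pQ uQ lQ RQ notC {CQ xQ yQ p1Q}.
pose C' := c :: rcons A r ++ R ++ q :: rev Q1.
have qQ : q \in Q1 ++ q :: Q2 by rewrite mem_cat mem_head orbT.
move: pQ; rewrite cat_path /= => /and3P[pQ1 lQ1 pQ2].
move: uQ; rewrite cat_uniq /= negb_or => /and4P[uQ1 /andP[qQ1 Q12] qQ2 uQ2].
apply: (IHn C' q Q2); last 1 first.
- apply/hasPn=> w wQ2; rewrite /C' /= inE !mem_cat inE mem_rev.
  have wQ : w \in Q1 ++ q :: Q2 by rewrite mem_cat inE wQ2 !orbT.
  rewrite !negb_or; apply/and5P; split.
  + by apply: contraNneq (notC _ wQ) => ->.
  + by apply: contra (notC _ wQ) => /AC.
  + by apply: contraL wQ => /RQ.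
  + by apply: contraNneq qQ2 => <-.
  + by apply: contra Q12 => wQ1; apply/hasP; exists w.
- by move: szQ; rewrite size_cat /= addnS ltnS; apply/leq_trans/leq_addl.
- apply/andP; split.
    have -> : cycle g C' =
        path g c (rcons A r ++ rcons R q ++ rcons (rev Q1) c).
      by rewrite (cat_rcons q) -rcons_cons -!rcons_cat.
    rewrite !cat_path !last_rcons pA pR /=.
    move: (rev_path g c (rcons Q1 q)); rewrite last_rcons belast_rcons rev_cons.
    move=> ->; rewrite (eq_path (e' := g)) => [|a b]; last exact: g_sym.
    by rewrite rcons_path pQ1.
  rewrite /C' -cat_cons cat_uniq uA cat_uniq /= mem_rev qQ1 rev_uniq uQ1.
  move: uR => /= /andP[_ ->]; rewrite /= !andbT.
  have inC w : w \in c :: rcons A r -> w \in C.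
    by rewrite inE => /predU1P[-> //|/AC].
  apply/andP; split.
    apply/hasPn => w; rewrite mem_cat inE mem_rev => wR.
    apply/negP => /inC wC; case/orP: wR => [/RnC/negP|wQ]; first by apply.
    move: wC; apply/negP; apply: notC; rewrite mem_cat inE.
    by case/orP: wQ => ->; rewrite ?orbT.
  rewrite negb_or; apply/andP; split.
    by apply/negP => /RQ; rewrite qQ.
  apply/hasPn => w; rewrite mem_rev => wQ1; apply/negP => /RQ.
  by rewrite mem_cat wQ1.
- by rewrite inE mem_cat xA orbT.
- by rewrite inE !mem_cat mem_head !orbT.
- by apply: contraNneq (notC _ qQ) => ->.
- by [].
- by [].
- by rewrite -lQ last_cat.
Qed.

(** A cycle may here be [:: x; c] with g x c: the growth starts from such a
degenerate cycle, and the conclusion may be one if x and y are adjacent. *)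
Lemma cycle_through_pair (x y : T) :
    x != y -> connect g x y ->
    (forall z, z != x -> z != y ->
       connect [rel a b | g a b && (b != z)] x y) ->
  exists C, [/\ ucycle g C, x \in C & y \in C].
Proof.
move=> xy /connectP[p0 /shortenP[p pp up _] lp {p0}] bypass.
case: p pp up lp => [_ _ yx|c p]; first by rewrite yx eqxx in xy.
rewrite /= inE negb_or => /andP[gxc pc] /and3P[/andP[xc xp] cp up] lp.
apply: (grow_cycle (C := [:: x; c]) (c := c) bypass (leqnn (size p))) => //.
- by rewrite /ucycle /= (g_sym c) gxc inE xc.
- by rewrite mem_head.
- by rewrite !inE eqxx orbT.
- by rewrite eq_sym.
- by rewrite has_sym /= (negPf xp) (negPf cp).
Qed.

End TwoPaths.

(** * Separations in chordless graphs *)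

Section Chordless.

Variables (T : finType) (e : rel T).
Hypotheses (e_sym : symmetric e) (e_irr : irreflexive e).

Lemma chordless_sub (r : rel T) : subrel r e -> chordless e -> chordless r.
Proof.
move=> re che c [sc /andP[cyc uc]] a b ac bc nab.
have ce : ucycle e c.
  rewrite /ucycle uc andbT.
  by case: c cyc {sc uc ac bc nab} => // w c; apply: sub_path.
by apply: contra (che c (conj sc ce) a b ac bc nab); apply: re.
Qed.

(** If no vertex z separated x from y once the edge xy is removed, a cycle of
the remaining graph would pass through x and y, and xy would be a chord of it.
The set X is what x reaches without z and without that edge.  The third vertex
w is there so that z always exists, even if the edge xy is a bridge. *)
Lemma chordless_separation (x y w : T) :
    chordless e -> e x y -> w != x -> w != y ->
  exists (X : {set T}) (z : T), [/\ x \in X, y \notin X, z \notin X & z != y] /\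
    forall a b, a \in X -> b \notin X -> e a b -> b = z \/ a = x /\ b = y.
Proof.
move=> che exy wx wy.
have xy : x != y by apply: contraTneq exy => ->; rewrite e_irr.
pose g := [rel a b |
  e a b && ~~ ((a == x) && (b == y) || (a == y) && (b == x))].
have g_sym : symmetric g.
  by move=> a b /=; rewrite e_sym orbC (andbC (a == y)) (andbC (a == x)).
pose gz z := [rel a b | g a b && (b != z)].
have [z /and3P[zx zy xzy]|bypass] :=
    pickP (fun z => [&& z != x, z != y & ~~ connect (gz z) x y]).
  exists [set v | connect (gz z) x v], z; split.
    rewrite !inE connect0 xzy zy; split=> //.
    apply/connectP=> -[p pp zp]; case/lastP: p => [|p v] in pp zp.
      by rewrite zp eqxx in zx.
    move: pp; rewrite last_rcons in zp; rewrite rcons_path -zp.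
    by rewrite /= eqxx andbF andbF.
  move=> a b; rewrite !inE => xa xb eab.
  have [->|bz] := eqVneq b z; first by left.
  have [/andP[/eqP-> /eqP->]|ab] := boolP ((a == x) && (b == y)).
    by right.
  have [/andP[/eqP ay _]|ba] := boolP ((a == y) && (b == x)).
    by rewrite ay (negPf xzy) in xa.
  case/negP: xb; apply: connect_trans xa (connect1 _).
  by rewrite /= eab bz (negPf ab) (negPf ba).
have byp z : z != x -> z != y -> connect (gz z) x y.
  by move=> zx zy; have := bypass z; rewrite zx zy /= => /negPn.
have gxy : connect g x y.
  by apply: connect_sub (byp w wx wy) => a b /= /andP[gab _]; apply: connect1.
have [C [ucC xC yC]] := cycle_through_pair g_sym xy gxy byp.
have gC a b : a \in C -> b = next C a -> g a b.
  by move=> aC ->; case/andP: ucC => cycC _; exact: (next_cycle cycC aC).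
have nxy : ~~ consecutive C x y.
  rewrite /consecutive negb_or; apply/andP; split.
    by apply/eqP => /(gC _ _ xC); rewrite /= !eqxx andbF.
  by apply/eqP => /(gC _ _ yC); rewrite /= !eqxx orbT andbF.
have ucCe : ucycle e C.
  case/andP: ucC => cycC uC; rewrite /ucycle uC andbT.
  by case: C cycC {gC uC xC yC nxy} => // v C; apply: sub_path => a b /andP[].
suff szC : 2 < size C.
  by have := che C (conj szC ucCe) x y xC yC nxy; rewrite exy.
case: C {ucCe gC} nxy xC yC ucC => [|a [|b [|c C]]] //= nxy.
  by rewrite !inE => /eqP ax /eqP ay; rewrite ax ay eqxx in xy.
rewrite !inE; case/predU1P=> [ax|/eqP bx]; case/predU1P=> [ay|/eqP yb].
- by rewrite ax ay eqxx in xy.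
- by subst; rewrite /ucycle /= !eqxx /= andbF.
- by subst; rewrite /ucycle /= !eqxx orbT andbF.
- by rewrite bx yb eqxx in xy.
Qed.

End Chordless.

(** * Sets of vertices with few exits *)

(** The set D and the hypotheses on it describe what an irreducible chordless
graph looks like once its vertices of degree at most 1 are deleted. *)
Section Lobes.

Variables (T : finType) (h : rel T) (D : {set T}).
Hypotheses (h_sym : symmetric h) (h_irr : irreflexive h).
Hypothesis h_chordless : chordless h.
Hypothesis D_deg : forall x, x \in D -> 3 <= degree h x.
Hypothesis D_degD : forall x, x \in D -> 2 <= #|[set y in D | h x y]|.
Hypothesis h_deg : forall x y, h x y -> 2 <= degree h x.
Hypothesis h_D : forall x y, h x y -> (x \in D) || (y \in D).

Definition exits_at (A : {set T}) (z : T) :=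
  [forall a in A, forall b in ~: A, h a b ==> (b == z)].

(** The counterpart of an end block (without its cutvertex z): a set that can
be left only towards z. *)
Definition lobe (A : {set T}) :=
  [exists d in D, d \in A] && [exists z, exits_at A z].

Definition exits_by (A : {set T}) (x y z : T) :=
  [forall a in A, forall b in ~: A, h a b ==> (b == z) || (a == x) && (b == y)].

(** A set such as those that [chordless_separation] cuts out of the graph: it
can be left only towards z or along the edge xy, where x is in D. *)
Definition wedge (A : {set T}) :=
  [exists x in A, (x \in D) &&
    [exists y, [&& h x y, y \notin A & [exists z, exits_by A x y z]]]].

Lemma exits_atP (A : {set T}) z :
  reflect (forall a b, a \in A -> b \notin A -> h a b -> b = z) (exits_at A z).
Proof.
apply: (iffP forall_inP) => [H a b aA bA hab | H a aA].
  by have /forall_inP/(_ b) := H a aA; rewrite inE bA hab => /(_ isT)/eqP.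
by apply/forall_inP => b; rewrite inE => bA; apply/implyP => /(H a b aA bA)->.
Qed.

Lemma exits_byP (A : {set T}) x y z :
  reflect (forall a b, a \in A -> b \notin A -> h a b ->
             b = z \/ a = x /\ b = y) (exits_by A x y z).
Proof.
apply: (iffP forall_inP) => [H a b aA bA hab | H a aA].
  have /forall_inP/(_ b) := H a aA; rewrite inE bA hab => /(_ isT)/=.
  by case/orP=> [/eqP|/andP[/eqP ? /eqP ?]]; [left | right].
apply/forall_inP => b; rewrite inE => bA; apply/implyP => /(H a b aA bA).
by case=> [->|[-> ->]]; rewrite !eqxx ?orbT.
Qed.

Lemma avoid1 (S : {set T}) (u : T) : 2 <= #|S| -> exists2 w, w \in S & w != u.
Proof.
move=> S2; have: 0 < #|S :\ u|.
  rewrite -ltnS; apply: leq_trans S2 _.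
  by rewrite (cardsD1 u S); case: (u \in S).
by case/card_gt0P=> w /setD1P[wu wS]; exists w.
Qed.

Lemma avoid2 (S : {set T}) (u v : T) :
  3 <= #|S| -> exists2 w, w \in S & w != u /\ w != v.
Proof.
move=> S3; have: 2 <= #|S :\ u|.
  rewrite -ltnS; apply: leq_trans S3 _.
  by rewrite (cardsD1 u S); case: (u \in S).
by case/(@avoid1 _ v) => w /setD1P[wu wS] wv; exists w.
Qed.

(** A non-isolated vertex that is not in D has two neighbors, all of them in D;
one of them is not z, and so belongs to A. *)
Lemma lobe_intro (A : {set T}) a b z :
  a \in A -> h a b -> exits_at A z -> lobe A.
Proof.
move=> aA hab ex; apply/andP; split; last by apply/existsP; exists z.
have [aD|aD] := boolP (a \in D); first by apply/existsP; exists a; rewrite aD.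
have [w] := avoid1 z (h_deg hab); rewrite inE => haw wz.
apply/existsP; exists w; move: (h_D haw); rewrite (negPf aD) /= => -> /=.
by apply: contraR wz => wA; apply/eqP/((exits_atP _ _ ex) a).
Qed.

Lemma wedge_intro (A : {set T}) x y z :
  x \in A -> x \in D -> h x y -> y \notin A -> exits_by A x y z -> wedge A.
Proof.
move=> xA xD hxy yA ex; apply/existsP; exists x; rewrite xA xD.
by apply/existsP; exists y; rewrite hxy yA; apply/existsP; exists z.
Qed.

Lemma separationD x y : x \in D -> h x y ->
  exists (X : {set T}) (z : T), [/\ x \in X, y \notin X, z \notin X & z != y] /\
    forall a b, a \in X -> b \notin X -> h a b -> b = z \/ a = x /\ b = y.
Proof.
move=> /D_deg dx hxy; have [w] := avoid1 y (ltnW dx); rewrite inE => hxw wy.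
have wx : w != x by apply: contraTneq hxw => ->; rewrite h_irr.
exact: chordless_separation wx wy.
Qed.

Section MinimalLobe.

Variable A0 : {set T}.
Hypothesis A0_min : minset lobe A0.

Lemma no_smaller_lobe (B : {set T}) a b z w :
    a \in B -> h a b -> exits_at B z -> B \subset A0 ->
    w \in A0 -> w \notin B ->
  False.
Proof.
move=> aB hab ex sBA wA wB; have lB := lobe_intro aB hab ex.
by case/minsetP: A0_min => _ /(_ B lB sBA) eqB; rewrite eqB wA in wB.
Qed.

(** The edge xy would be a bridge.  The exit z0 of the minimal lobe A0 is on one
side of it, and the other side cuts a smaller lobe out of A0, whose exit is x:
it is the part of S in A0 if z0 is not in S, and what remains of A0 without S and
without x otherwise. *)
Lemma no_bridge (S : {set T}) x y :
    x \in A0 -> x \in D -> x \notin S -> y \in S -> h x y ->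
    (forall a b, a \in S -> b \notin S -> h a b -> a = y /\ b = x) ->
  False.
Proof.
move=> xA xD xS yS hxy cross.
have /minsetp/andP[_ /existsP[z0 /exits_atP ex0]] := A0_min.
have [z0S|z0S] := boolP (z0 \in S).
  have [w] := avoid1 y (ltnW (D_deg xD)); rewrite inE => hxw wy.
  have wx : w != x by apply: contraTneq hxw => ->; rewrite h_irr.
  have wS : w \notin S.
    apply/negP => wS; case: (cross w x wS xS); first by rewrite h_sym.
    by move/eqP; rewrite (negPf wy).
  have wA : w \in A0.
    by apply: contraNT wS => wA; rewrite (ex0 x w xA wA hxw).
  apply: (@no_smaller_lobe ((A0 :\: S) :\ x) w x x x) => //.
  - by rewrite !inE wx wA wS.
  - by rewrite h_sym.
  - apply/exits_atP => a b; rewrite !inE => /and3P[ax aS aA].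
    rewrite !negb_and !negbK => /or3P[/eqP //|bS|bA] hab.
      case: (cross b a bS aS); first by rewrite h_sym.
      by move=> _ ax'; rewrite ax' eqxx in ax.
    have bz := ex0 a b aA bA hab; rewrite -bz in z0S.
    case: (cross b a z0S aS); first by rewrite h_sym.
    by move=> _ ax'; rewrite ax' eqxx in ax.
  - by apply: subset_trans (subD1set _ _) (subsetDl _ _).
  - by rewrite !inE eqxx.
have yA : y \in A0.
  by apply: contraNT z0S => yA; rewrite -(ex0 x y xA yA hxy).
apply: (@no_smaller_lobe (S :&: A0) y x x x) => //.
- by rewrite inE yS.
- by rewrite h_sym.
- apply/exits_atP => a b; rewrite !inE => /andP[aS aA].
  rewrite negb_and => /orP[bS|bA] hab; first by case: (cross a b aS bS hab).
  have [bS|bS] := boolP (b \in S); last by case: (cross a b aS bS hab).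
  by rewrite -(ex0 a b aA bA hab) bS in z0S.
- exact: subsetIr.
- by rewrite inE (negPf xS).
Qed.

(** A vertex d of D in A0 has a neighbor v in D other than the exit of A0, so v
is also in A0.  Separate d from v: the side that does not contain the exit of A0
is a wedge, up to what lies outside of A0. *)
Lemma wedge_in_lobe : exists2 A, wedge A & A \subset A0.
Proof.
have /minsetp/andP[/exists_inP[d dD dA] /existsP[z0 /exits_atP ex0]] := A0_min.
have [v] := avoid1 z0 (D_degD dD); rewrite inE => /andP[vD hdv] vz0.
have vA : v \in A0 by apply: contraR vz0 => vA; apply/eqP/(ex0 d).
have [X [z [[dX vX zX zv] exX]]] := separationD dD hdv.
have [z0X|z0X] := boolP (z0 \in X).
  exists ((~: X :\ z) :&: A0); last exact: subsetIr.
  apply: (@wedge_intro _ v d z) => //.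
  - by rewrite !inE eq_sym zv vX vA.
  - by rewrite h_sym.
  - by rewrite !inE dX /= andbF.
  apply/exits_byP => a b; rewrite !inE => /andP[/andP[az aX] aA] bB hab.
  have [->|bz] := eqVneq b z; first by left.
  have [bX|bX] := boolP (b \in X).
    have [|az'|[-> ->]] := exX b a bX aX; rewrite 1?h_sym //; last by right.
    by rewrite az' eqxx in az.
  have bA : b \notin A0 by rewrite bz bX in bB.
  by rewrite (ex0 a b aA bA hab) z0X in bX.
exists (X :&: A0); last exact: subsetIr.
apply: (@wedge_intro _ d v z) => //; first by rewrite inE dX.
  by rewrite inE (negPf vX).
apply/exits_byP => a b; rewrite !inE => /andP[aX aA] bB hab.
have [bX|bX] := boolP (b \in X); last exact: exX.
have bA : b \notin A0 by rewrite bX in bB.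
by rewrite -(ex0 a b aA bA hab) bX in z0X.
Qed.

(** Take a minimal wedge A in A0, with exits z and xy, and a neighbor x' <> y of
x in D.  Separate x from x' by z', so that X is the side of x.  If z is not on
the side of x', then the part of A on that side is a smaller wedge.  Otherwise,
if z' is outside of A, all edges leaving the part of A on the side of x start
at x, and without x this part is a lobe.  If z' is in A, then xy is a bridge,
the side of y being X minus A. *)
Lemma no_minimal_lobe : False.
Proof.
have [A1 wA1 sA1] := wedge_in_lobe.
pose P (A : {set T}) := wedge A && (A \subset A0).
have [A] : {A | minset P A & A \subset A1} by apply: minset_exists; apply/andP.
case/minsetP=> /andP[] /exists_inP[x xA /andP[xD /existsP[y]]].
case/and3P=> hxy yA /existsP[z /exits_byP exA] sA Amin _.
have [x'] := avoid1 y (D_degD xD); rewrite inE => /andP[x'D hxx'] x'y.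
have [X [z' [[xX x'X z'X z'x'] exX]]] := separationD xD hxx'.
have xA0 := subsetP sA x xA.
have xx' : x != x' by apply: contraTneq hxx' => ->; rewrite h_irr.
have z'x : z' != x by apply: contraNneq z'X => ->.
have [zX'|zX'] := boolP ((z \in X) || (z == z')).
  have x'A : x' \in A.
    apply: contraLR zX' => x'A.
    have [<-|[_ yx']] := exA x x' xA x'A hxx'; last by rewrite yx' eqxx in x'y.
    by rewrite negb_or x'X eq_sym.
  pose B := (~: X :\ z') :&: A.
  have xB : x \notin B by rewrite !inE xX andbF.
  suff BA : B = A by rewrite BA xA in xB.
  apply: Amin; last exact: subsetIr.
  rewrite /P (subset_trans (subsetIr _ _) sA) andbT.
  apply: (@wedge_intro _ x' x z') => //.
  - by rewrite !inE eq_sym z'x' x'X x'A.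
  - by rewrite h_sym.
  apply/exits_byP => a b; rewrite !inE => /andP[/andP[az aX] aA] bB hab.
  have [->|bz] := eqVneq b z'; first by left.
  have [bX|bX] := boolP (b \in X).
    have [|az'|[-> ->]] := exX b a bX aX; rewrite 1?h_sym //; last by right.
    by rewrite az' eqxx in az.
  have bA : b \notin A by rewrite bz bX in bB.
  have [bz0|[ax _]] := exA a b aA bA hab; last by rewrite ax xX in aX.
  by rewrite -bz0 (negPf bX) (negPf bz) in zX'.
move: zX'; rewrite negb_or => /andP[zX zz'].
have [z'A|z'A] := boolP (z' \in A).
  apply: (@no_bridge (X :\: A) x y) => //.
  - by rewrite !inE xA.
  - rewrite inE yA; apply: contraTT isT => yX.
    have [yz'|[_ yx']] := exX x y xX yX hxy; first by rewrite yz' z'A in yA.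
    by rewrite yx' eqxx in x'y.
  move=> a b; rewrite !inE => /andP[aA aX] bB hab.
  have bA : b \in A.
    apply: contraR bB => bA; rewrite bA /=; apply: contraR bA => bX.
    by have [-> //|[ax _]] := exX a b aX bX hab; rewrite ax xA in aA.
  have [|az|[-> ->] //] := exA b a bA aA; first by rewrite h_sym.
  by rewrite az (negPf zX) in aX.
have [w] := avoid2 y x' (D_deg xD); rewrite inE => hxw [wy wx'].
have wx : w != x by apply: contraTneq hxw => ->; rewrite h_irr.
apply: (@no_smaller_lobe ((X :&: A) :\ x) w x x x) => //.
- have wX : w \in X.
    apply: contraR z'A => wX.
    have [wz'|[_ wx'']] := exX x w xX wX hxw; last by rewrite wx'' eqxx in wx'.
    rewrite -wz'; apply: contraR zz' => wA.
    have [<-|[_ wy']] := exA x w xA wA hxw; first by rewrite wz'.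
    by rewrite wy' eqxx in wy.
  rewrite !inE wx wX; apply: contraR zX => wA.
  have [<- //|[_ wy']] := exA x w xA wA hxw.
  by rewrite wy' eqxx in wy.
- by rewrite h_sym.
- apply/exits_atP => a b; rewrite !inE => /and3P[ax aX aA] bB hab.
  apply/eqP; apply: contraR ax => bx; rewrite bx /= in bB.
  have [bA|bA] := boolP (b \in A).
    have bX : b \notin X by rewrite bA andbT in bB.
    by have [bz'|[-> //]] := exX a b aX bX hab; rewrite -bz' bA in z'A.
  have [bz|[-> //]] := exA a b aA bA hab.
  have bX : b \notin X by rewrite bz.
  by have [bz'|[-> //]] := exX a b aX bX hab; rewrite -bz bz' eqxx in zz'.
- by apply: subset_trans (subD1set _ _) (subset_trans (subsetIr _ _) sA).
- by rewrite !inE eqxx.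
Qed.

End MinimalLobe.

Lemma no_branching_core : D = set0.
Proof.
apply/eqP; apply: contraT => /set0Pn[d dD].
have lobeT : lobe setT.
  apply/andP; split; first by apply/existsP; exists d; rewrite dD inE.
  by apply/existsP; exists d; apply/exits_atP => a b _; rewrite inE.
by have [A Amin _] := minset_exists lobeT; case: (no_minimal_lobe Amin).
Qed.

End Lobes.

(** * Reducible configurations *)

(** If there is no such edge, then a vertex with a neighbor of degree at most 2
has two neighbors of degree at least 3, and a vertex with a neighbor of degree 1
has three of degree at least 2.  The graph h without the vertices of degree at
most 1 therefore satisfies the hypotheses of [no_branching_core], which leaves
no vertex of degree at least 3; but one of the ends of any edge is such a
vertex. *)
Lemma chordless_reducible (T : finType) (r : rel T) :
    symmetric r -> irreflexive r -> chordless r -> (exists x y, r x y) ->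
  exists v u, r v u /\
    (degree r u <= 2 /\ #|[set w | r v w & 2 < degree r w]| <= 1 \/
     degree r u = 1 /\ #|[set w | r v w & 1 < degree r w]| <= 2).
Proof.
move=> r_sym r_irr r_ch [x0 [y0 r0]].
pose opA v u := (degree r u <= 2) && (#|[set w | r v w & 2 < degree r w]| <= 1).
pose opB v u := (degree r u == 1) && (#|[set w | r v w & 1 < degree r w]| <= 2).
have [[v u] /= /andP[rvu /orP[/andP[]|/andP[/eqP]]]|noop] :=
    pickP (fun p : T * T => r p.1 p.2 && (opA p.1 p.2 || opB p.1 p.2)).
- by exists v, u; split=> //; left.
- by exists v, u; split=> //; right.
have noA v u : r v u -> degree r u <= 2 ->
    1 < #|[set w | r v w & 2 < degree r w]|.
  move=> rvu du; have := noop (v, u).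
  by rewrite /= rvu /opA du /= ltnNge => /negbT; rewrite negb_or => /andP[].
have noB v u : r v u -> degree r u = 1 ->
    2 < #|[set w | r v w & 1 < degree r w]|.
  move=> rvu du; have := noop (v, u).
  by rewrite /= rvu /opB du /= ltnNge => /negbT; rewrite negb_or => /andP[].
have deg_gt0 u v : r u v -> 0 < degree r v.
  by move=> ruv; apply/card_gt0P; exists u; rewrite inE r_sym.
pose h := [rel u v | [&& r u v, 1 < degree r u & 1 < degree r v]].
pose D := [set u | 2 < degree r u].
have sub_big v : [set w | r v w & 2 < degree r w] \subset [set w | r v w].
  by apply/subsetP => w; rewrite !inE => /andP[].
have low_big u v : r u v -> degree r v <= 2 -> 2 < degree r u.
  move=> ruv dv; apply: leq_ltn_trans (noA _ _ ruv dv) _.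
  apply/proper_card/properP; split=> //; exists v; rewrite !inE ruv //=.
  by rewrite -leqNgt.
have h_degE u : 1 < degree r u ->
    degree h u = #|[set w | r u w & 1 < degree r w]|.
  by move=> du; apply: eq_card => w; rewrite !inE /= du.
have h_degD u : 1 < degree r u -> minn 3 (degree r u) <= degree h u.
  move=> du; rewrite h_degE //.
  have [l /andP[rul dl]|noleaf] := pickP (fun l => r u l && (degree r l <= 1)).
    rewrite geq_min (@noB u l) //; apply/eqP; rewrite eqn_leq dl.
    exact: deg_gt0 rul.
  rewrite geq_min; apply/orP; right; apply/subset_leq_card/subsetP => w.
  rewrite !inE => ruw; rewrite ruw ltnNge.
  by have := noleaf w; rewrite ruw => /negbT.
have D0 : D = set0.
  apply: (@no_branching_core T h D).
  - by move=> u v /=; rewrite r_sym (andbC (1 < degree r v)).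
  - by move=> u /=; rewrite r_irr.
  - by apply: chordless_sub r_ch => u v /and3P[].
  - move=> u; rewrite inE => du; apply: leq_trans (h_degD u (ltnW du)).
    by rewrite leq_min leqnn.
  - move=> u; rewrite inE => du.
    have -> : [set w in D | h u w] = [set w | r u w & 2 < degree r w].
      apply/setP => w; rewrite !inE /= (ltnW du) /= andbC.
      by case: (boolP (2 < degree r w)) => [/ltnW->|]; rewrite ?andbT ?andbF.
    have [l /andP[rul dl]|nolow] := pickP (fun l => r u l && (degree r l <= 2)).
      exact: noA rul dl.
    apply: ltnW; apply: leq_trans du _; apply/subset_leq_card/subsetP => w.
    rewrite !inE => ruw; rewrite ruw ltnNge.
    by have := nolow w; rewrite ruw => /negbT.
  - move=> u v /and3P[_ du _]; apply: leq_trans (h_degD u du).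
    by rewrite leq_min du.
  move=> u v /and3P[ruv _ _]; rewrite !inE.
  by case: (leqP (degree r v) 2) => [/(low_big _ _ ruv)->|]; rewrite ?orbT.
have := in_set0 x0; have := in_set0 y0; rewrite -D0 !inE => dy.
by rewrite (low_big _ _ r0) // leqNgt dy.
Qed.

(** * Greedy coloring *)

Definition proper_coloring (V : finType) (g : rel V) (k : nat) (S : {set V})
    (c : V -> 'I_k) : Prop :=
  {in S &, forall A B, A != B -> g A B -> c A != c B}.

Lemma greedy_extension (V : finType) (g : rel V) (k : nat) (E S : {set V})
    (c : V -> 'I_k) :
    symmetric g -> E \subset S ->
    (forall A, A \in S :\: E -> #|[set B in S | (B != A) && g A B]| < k) ->
    proper_coloring g E c -> exists c' : V -> 'I_k, proper_coloring g S c'.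
Proof.
move=> g_sym; move: {2}#|_|.+1 (ltnSn #|S :\: E|) => n.
elim: n => // n IHn in E c * => szSE sES few propE.
have [SE0|[A ASE]] := set_0Vmem (S :\: E).
  exists c; suff -> : S = E by [].
  by apply/eqP; rewrite eqEsubset sES -setD_eq0 SE0 eqxx.
have /setDP[AS AE] := ASE.
pose used := c @: [set B in S | (B != A) && g A B].
have [i iused] : exists i, i \notin used.
  apply/existsP; rewrite -negb_forall.
  apply: contraL (few A ASE) => /forallP all.
  rewrite -leqNgt -{1}(card_ord k) -cardsT.
  apply: leq_trans (leq_imset_card c _); apply/subset_leq_card/subsetP=> j _.
  exact: all.
have free B : B \in E -> g A B -> c B != i.
  move=> BE gAB; apply: contraNneq iused => <-; apply: imset_f; rewrite inE gAB.
  by rewrite (subsetP sES) // andbT; apply: contraNneq AE => <-.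
apply: (IHn (A |: E) (fun B => if B == A then i else c B)).
- rewrite ltnS in szSE; apply: leq_trans szSE; apply/proper_card/properP; split.
    by apply/setDS/subsetUr.
  by exists A; rewrite // !inE eqxx.
- by rewrite subUset sub1set AS.
- move=> B; rewrite in_setD => /andP[BAE BS]; apply: few; rewrite inE BS andbT.
  by apply: contra BAE => BE; rewrite inE BE orbT.
move=> B C; rewrite !inE.
case: eqVneq => [->|BA] /= BE; case: eqVneq => [->|CA] /= CE.
- by rewrite eqxx.
- by move=> _ gAC; rewrite eq_sym free.
- by move=> _ gBA; rewrite free // g_sym.
- exact: propE.
Qed.

(** * Conflicts between edges *)

Section StrongColoring.

Variables (T : finType) (e : rel T).
Hypotheses (e_sym : symmetric e) (e_irr : irreflexive e).

(** Distinct edges that share an end are also in conflict in this sense: the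
shared end is adjacent to the other end of either edge. *)
Definition conflict (A B : {set T}) := [exists a in A, exists b in B, e a b].

Lemma conflictP (A B : {set T}) :
  reflect (exists a b, [/\ a \in A, b \in B & e a b]) (conflict A B).
Proof.
apply: (iffP exists_inP) => [[a aA /exists_inP[b bB eab]]|[a [b [aA bB eab]]]].
  by exists a, b.
by exists a => //; apply/exists_inP; exists b.
Qed.

Lemma conflict_sym : symmetric conflict.
Proof.
move=> A B; apply/conflictP/conflictP => -[a [b [aA bB eab]]];
  by exists b, a; rewrite e_sym.
Qed.

Lemma edgesP (r : rel T) (B : {set T}) :
  reflect (exists a b, r a b /\ B = [set a; b]) (B \in edges r).
Proof.
apply: (iffP imsetP) => [[[a b]]|[a [b [rab ->]]]].
  by rewrite inE /= => rab ->; exists a, b.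
by exists (a, b); rewrite ?inE.
Qed.

Lemma degree_sub (r : rel T) x : subrel r e -> degree r x <= degree e x.
Proof.
by move=> re; apply/subset_leq_card/subsetP => y; rewrite !inE; apply: re.
Qed.

Lemma degree_max (r : rel T) x : subrel r e -> degree r x <= max_degree e.
Proof. by move=> re; rewrite (leq_trans (degree_sub x re)) // leq_bigmax. Qed.

(** Each such edge B has an end adjacent to v or u.  If this end is adjacent to
v and differs from u, then B is counted there.  If it is u, then the other end
of B is a neighbor of u other than v, since B is not the edge vu, and B is
counted there.  The case of an end adjacent to u is symmetric. *)
Lemma card_conflicts (r : rel T) v u : symmetric r -> subrel r e ->
  #|[set B in edges r | (B != [set v; u]) && conflict [set v; u] B]| <=
    \sum_(x | e v x && (x != u)) degree r x +
    \sum_(x | e u x && (x != v)) degree r x.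
Proof.
move=> r_sym re.
pose star x := [set [set x; y] | y in [set y | r x y]].
pose near a b := \bigcup_(x | e a x && (x != b)) star x.
have card_near a b : #|near a b| <= \sum_(x | e a x && (x != b)) degree r x.
  rewrite /near; elim/big_rec2: _ => [|x n U _ IH]; first by rewrite cards0.
  by rewrite (leq_trans (leq_card_setU _ _)) // leq_add // leq_imset_card.
apply: leq_trans (leq_add (card_near v u) (card_near u v)).
apply: leq_trans (leq_card_setU _ _); apply/subset_leq_card/subsetP => B.
rewrite inE => /and3P[/edgesP[p [q [rpq ->]]] neB /conflictP[a [b []]]].
have in_near y z s t : r s t -> e y s -> s != z -> [set s; t] \in near y z.
  move=> rst eys sz; apply/bigcupP; exists s; first by rewrite eys.
  by apply: imset_f; rewrite inE.
have key y z s t : [set s; t] != [set y; z] -> r s t -> e y s ->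
    ([set s; t] \in near y z) || ([set s; t] \in near z y).
  move=> ne rst eys; have [sz|sz] := eqVneq s z; last by rewrite in_near.
  apply/orP; right; rewrite setUC; apply: in_near; first by rewrite r_sym.
    by rewrite -sz; apply: re.
  by apply: contraNneq ne => ->; rewrite sz setUC.
have key2 y z : [set p; q] != [set y; z] -> b \in [set p; q] -> e y b ->
    ([set p; q] \in near y z) || ([set p; q] \in near z y).
  move=> ne; rewrite !inE => /orP[]/eqP-> eyb; first exact: key.
  by rewrite setUC; apply: key => //; rewrite 1?setUC // r_sym.
rewrite in_set2 => /orP[]/eqP-> bpq eab; rewrite in_setU; first exact: key2.
by rewrite orbC; apply: key2 => //; rewrite (setUC [set u]).
Qed.

(** * Peeling off the edges *)

(** The invariant of the peeling, r being the graph of the present edges and e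
the whole graph: a removed edge makes at most one pair of present edges, one at
each of its ends, conflict. *)
Definition removal_inert (r : rel T) := forall x y,
  e x y -> ~~ r x y -> 0 < degree r x -> 0 < degree r y -> degree r x <= 1.

Section Counting.

Variable r : rel T.
Hypotheses (r_sym : symmetric r) (re : subrel r e) (r_inert : removal_inert r).

Let d := max_degree e.

Lemma card_other_neighbors u v :
  e u v -> #|[set x | e u x && (x != v)]| <= d.-1.
Proof.
move=> euv; have := leq_bigmax (F := degree e) u; rewrite -/d /degree.
rewrite (cardsD1 v) inE euv.
have -> : [set y | e u y] :\ v = [set x | e u x && (x != v)].
  by apply/setP=> w; rewrite !inE andbC.
rewrite -/(max_degree e) -/d; lia.
Qed.

Lemma degree_removed x y :
  e x y -> ~~ r x y -> 0 < degree r x -> degree r y <= 1.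
Proof.
move=> exy rxy dx; have [->//|dy] := posnP (degree r y).
by apply: (r_inert (y := x)); rewrite 1?e_sym 1?r_sym.
Qed.

Lemma degree_gt0 x y : r x y -> 0 < degree r x.
Proof. by move=> rxy; apply/card_gt0P; exists y; rewrite inE. Qed.

Lemma sum_at_leaf u v : r u v -> degree r u <= 1 ->
  \sum_(x | e u x && (x != v)) degree r x <= d.-1.
Proof.
move=> ruv du; apply: leq_trans (card_other_neighbors (re ruv)).
rewrite cardsE -sum1_card; apply: leq_sum => x /andP[eux xv].
apply: degree_removed (degree_gt0 ruv) => //; apply/negP => rux.
move: du; rewrite leqNgt => /negP; apply; apply/card_gt1P.
by exists x, v; rewrite !inE rux ruv.
Qed.

(** If u has a present edge besides uv, leading to a vertex u', then the other
neighbors of u are ends of removed edges, and by the invariant they have no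
present edge, so u' accounts for the whole sum. *)
Lemma sum_at_low u v : r u v -> degree r u <= 2 ->
  \sum_(x | e u x && (x != v)) degree r x <= d.
Proof.
move=> ruv du2; have [du1|du1] := leqP (degree r u) 1.
  by apply: leq_trans (sum_at_leaf ruv du1) (leq_pred _).
apply: (@leq_trans (\sum_(x | r u x && (x != v)) d)).
  rewrite big_mkcond [leqRHS]big_mkcond; apply: leq_sum => x _.
  have [rux|rux] := boolP (r u x).
    by rewrite (re rux) /=; case: (x != v) => //; apply: degree_max.
  case: ifP => // /andP[eux _]; have [->//|dx] := posnP (degree r x).
  by have := r_inert eux rux (degree_gt0 ruv) dx; rewrite leqNgt du1.
rewrite sum_nat_const.
rewrite -[leqRHS]mul1n leq_mul2r; apply/orP; right.
move: du2; rewrite /degree (cardsD1 v) inE ruv ltnS; congr (_ <= _).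
by apply: eq_card => x; rewrite !inE andbC.
Qed.

(** Every neighbor of v contributes at most t, except for the at most s
neighbors of larger degree, which contribute up to d - t more; by the invariant,
these are joined to v by present edges. *)
Lemma sum_at_center v u s t : r v u -> 0 < t ->
    #|[set w | r v w & t < degree r w]| <= s ->
  \sum_(x | e v x && (x != u)) degree r x <= t * d.-1 + (d - t) * s.
Proof.
move=> rvu t0 few.
apply: (@leq_trans (\sum_(x | e v x && (x != u))
                      (t + (d - t) * (r v x && (t < degree r x))))).
  apply: leq_sum => x /andP[evx _].
  have dx := degree_max x re; rewrite -/d in dx.
  have [rvx|rvx] /= := boolP (r v x).
    by case: ltnP => ?; lia.
  by have := degree_removed evx rvx (degree_gt0 rvu); lia.
rewrite big_split /= leq_add //.
  rewrite sum_nat_const mulnC leq_mul2l; apply/orP; right.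
  by have := card_other_neighbors (re rvu); rewrite cardsE.
rewrite -big_distrr /= leq_mul2l; apply/orP; right; apply: leq_trans few.
rewrite -sum1_card big_mkcond [leqRHS]big_mkcond; apply: leq_sum => x _.
by rewrite inE; case: ifP => // _; case: (_ && _).
Qed.

End Counting.

Definition remove_star (r : rel T) v (U : {set T}) : rel T :=
  [rel x y | r x y && ~~ ((x == v) && (y \in U) || (y == v) && (x \in U))].

Lemma degree_remove_star (r : rel T) v U x :
  degree (remove_star r v U) x <= degree r x.
Proof. by apply/subset_leq_card/subsetP => y; rewrite !inE => /andP[]. Qed.

Lemma degree_remove_star_lt (r : rel T) v (U : {set T}) x :
  symmetric r -> x \in U -> r v x -> degree (remove_star r v U) x < degree r x.
Proof.
move=> r_sym xU rvx; apply/proper_card/properP; split.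
  by apply/subsetP => y; rewrite !inE => /andP[].
by exists v; rewrite !inE 1?r_sym // /remove_star /= eqxx xU orbT andbF.
Qed.

Lemma remove_star_inert (r : rel T) v (U : {set T}) :
    removal_inert r ->
    (forall w, w \in U -> r v w -> 0 < degree (remove_star r v U) w ->
       degree (remove_star r v U) v <= 1 /\
       degree (remove_star r v U) w <= 1) ->
    symmetric r -> removal_inert (remove_star r v U).
Proof.
move=> r_inert starU r_sym p q epq; have [rpq|rpq] := boolP (r p q).
  rewrite {1}/remove_star /= rpq negbK.
  case/orP=> /andP[/eqP eqv wU] dp dq; subst v.
    by case: (starU q wU rpq dq).
  by case: (starU p wU _ dp) => //; rewrite r_sym.
move=> _ dp dq; apply: leq_trans (degree_remove_star _ _ _ _) _.
by apply: r_inert epq rpq _ _; apply: leq_trans (degree_remove_star _ v U _).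
Qed.

(** Induction on the number of present edges.  The removed star consists of all
the edges of the first kind at v, or of a single edge of the second kind; what
remains is colored by induction, and the star greedily. *)
Lemma strong_coloring_of_rest (n : nat) (r : rel T) :
    chordless e -> 1 <= max_degree e ->
    #|[set p | r p.1 p.2]| < n ->
    symmetric r -> subrel r e -> removal_inert r ->
  exists c : {set T} -> 'I_(4 * max_degree e - 4).+1,
    proper_coloring conflict (edges r) c.
Proof.
move=> che d1; set d := max_degree e in d1 *.
elim: n r => // n IHn r sz r_sym re r_inert.
have [[x y] /= rxy|noedge] := pickP (fun p : T * T => r p.1 p.2); last first.
  exists (fun=> ord0) => A B /edgesP[a [b [rab]]].
  by have := noedge (a, b); rewrite /= rab.
have r_irr : irreflexive r by move=> w; apply: contraFF (e_irr w); apply: re.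
have r_ch := chordless_sub re che.
have exr : exists x y, r x y by exists x, y.
have [v [u [rvu ops]]] := chordless_reducible r_sym r_irr r_ch exr.
have [U [uU sumU inert]] : exists U : {set T},
    [/\ u \in U,
        {in U, forall w, \sum_(x | e v x && (x != w)) degree r x +
                   \sum_(x | e w x && (x != v)) degree r x <= 4 * d - 4} &
        removal_inert (remove_star r v U)].
  have rwv w : r v w -> r w v by rewrite r_sym.
  case: ops => [[du few]|[du few]].
    exists [set w | r v w & degree r w <= 2]; split.
    - by rewrite inE rvu.
    - move=> w; rewrite inE => /andP[rvw dw].
      have := sum_at_center r_sym re r_inert rvw (t := 2) isT few.
      have := sum_at_low r_sym re r_inert (rwv _ rvw) dw; rewrite -/d.
      have := sum_at_leaf r_sym re r_inert (rwv _ rvw).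
      have := degree_max w re; rewrite -/d.
      (* For d = 1 the bound d on the sum at w is not enough, but then w has
         degree 1 and the bound d - 1 applies. *)
      by case: (ltnP 1 d) => ?; lia.
    apply: remove_star_inert => // w; rewrite inE => /andP[rvw dw] _ _; split.
      apply: leq_trans few; apply/subset_leq_card/subsetP => z.
      rewrite !inE /remove_star /= !inE eqxx /=.
      by case: (r v z) => //=; rewrite negb_or => /andP[]; rewrite -ltnNge.
    rewrite -ltnS; apply: leq_trans (dw); apply: degree_remove_star_lt => //.
    by rewrite inE rvw.
  exists [set u]; split.
  - by rewrite inE.
  - move=> w; rewrite inE => /eqP->.
    have := sum_at_center r_sym re r_inert rvu (t := 1) isT few.
    have := sum_at_leaf r_sym re r_inert (rwv _ rvu).
    by rewrite du -/d => /(_ isT); lia.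
  apply: remove_star_inert => // w; rewrite inE => /eqP-> _.
  have := degree_remove_star_lt r_sym (set11 u) rvu; rewrite du.
  by case: (degree _ u).
pose r' := remove_star r v U.
have r'_sym : symmetric r'.
  move=> p q; rewrite /r' /remove_star /= r_sym orbC.
  by case: (q == v); case: (p == v); rewrite ?orbT ?orbF.
have r'r : subrel r' r by move=> p q /andP[].
have szr' : #|[set p | r' p.1 p.2]| < n.
  rewrite ltnS in sz; apply: leq_trans sz; apply/proper_card/properP; split.
    by apply/subsetP => p; rewrite !inE => /andP[].
  by exists (v, u); rewrite !inE /r' /remove_star /= rvu //= eqxx uU.
have [c cP] := IHn r' szr' r'_sym (fun p q r'pq => re _ _ (r'r p q r'pq)) inert.
apply: (greedy_extension (E := edges r') conflict_sym _ _ cP).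
  apply/subsetP => A /edgesP[p [q [r'pq ->]]]; apply/edgesP.
  by exists p, q; split=> //; apply: r'r.
move=> A; rewrite in_setD => /andP[AE /edgesP[p [q [rpq defA]]]].
have [w wU ->] : exists2 w, w \in U & A = [set v; w].
  have : (p == v) && (q \in U) || (q == v) && (p \in U).
    apply: contraR AE => notU; apply/edgesP.
    by exists p, q; rewrite /r' /remove_star /= rpq.
  case/orP=> /andP[/eqP eqv wU]; rewrite defA eqv; first by exists q.
  by exists p; rewrite // setUC.
rewrite ltnS; apply: leq_trans (sumU w wU); exact: card_conflicts.
Qed.

End StrongColoring.

(** * The strong chromatic index *)

Lemma strong_edge_colorable_of_proper (T : finType) (e : rel T) (k : nat)
    (c : {set T} -> 'I_k) :
  symmetric e -> proper_coloring (conflict e) (edges e) c ->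
  strong_edge_colorable e k.
Proof.
move=> e_sym cP; apply/existsP; exists [ffun A : edge e => c (val A)].
apply/forallP=> i; apply/forall_inP=> A; rewrite inE ffunE => /eqP cA.
apply/forall_inP=> B; rewrite inE ffunE => /eqP cB; apply/implyP=> AB.
have far : ~~ conflict e (val A) (val B).
  apply/negP => /(cP _ _ (valP A) (valP B) AB).
  by rewrite cA cB eqxx.
have farP a b : a \in val A -> b \in val B -> ~~ e a b.
  by move=> aA bB; apply: contra far => eab; apply/conflictP; exists a, b.
apply/andP; split; last first.
  by apply/forall_inP=> a aA; apply/forall_inP=> b; apply: farP.
rewrite disjoint_subset; apply/subsetP => a aA; rewrite inE; apply/negP => aB.
have /edgesP[p [q [epq defB]]] := valP B.
move: aB; rewrite defB in_set2 => /orP[]/eqP ap.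
  by have := farP a q aA; rewrite defB set22 ap epq => /(_ isT).
by have := farP a p aA; rewrite defB set21 ap e_sym epq => /(_ isT).
Qed.

Theorem theorem5 (T : finType) (e : rel T)
    (e_sym : symmetric e) (e_irr : irreflexive e) :
  chordless e ->
  1 <= max_degree e ->
  strong_chromatic_index e <= 4 * max_degree e - 3.
Proof.
move=> che d1; rewrite /strong_chromatic_index; case: ex_minnP => m _; apply.
have -> : 4 * max_degree e - 3 = (4 * max_degree e - 4).+1 by lia.
have inert : removal_inert e e by move=> x y ->.
have [c cP] := strong_coloring_of_rest e_sym e_irr che d1 (ltnSn _) e_sym
  (fun _ _ => id) inert.
exact: strong_edge_colorable_of_proper cP.
Qed.
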